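(* Let $\gamma:[a,b]\subset\mathbb R\to\mathbb K\setminus\{0\}$ be a path. Then there exists a lift of $\gamma$ to $\mathcal E_{\mathbb K}^+$ if, and only if, there exists a continuation of the logarithm along $\gamma$.
   Context: $\mathbb K$ denotes either the algebra of quaternions or the algebra of octonions, $\operatorname{Im}(\mathbb K)$ its space of purely imaginary elements, and $\mathbb S=\{I\in\mathbb K: I^2=-1\}$. A path is a continuous map from a compact interval. The exponential is $\exp(q)=\sum_{k\ge 0}q^k/k!$, so $\exp(x+Iy)=e^x(\cos y+I\sin y)$ for $x,y\in\mathbb R$, $I\in\mathbb S$. The logarithm manifold is $\mathcal E_{\mathbb K}^+=\{(\sinh x\cos y+I\sinh x\sin y,\,Iy): x>0,\ y\in\mathbb R,\ I\in\mathbb S\}=\{(r\exp p,p): r>0,\ p\in\operatorname{Im}(\mathbb K)\}\subset\mathbb K\times\operatorname{Im}(\mathbb K)$, with the subspace topology, and $\mathrm{pr}_1:\mathcal E_{\mathbb K}^+\to\mathbb K\setminus\{0\}$, $(q,p)\mapsto q$. A lift of $\gamma$ to $\mathcal E_{\mathbb K}^+$ is a path $\Gamma:[a,b]\to\mathcal E_{\mathbb K}^+$ with $\mathrm{pr}_1\circ\Gamma=\gamma$. A continuation of the logarithm along $\gamma$ is a path $\widetilde\gamma:[a,b]\to\mathbb K$ with $\exp\circ\widetilde\gamma=\gamma$. *)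

(* Defs.v *)
From HB Require Import structures.
From mathcomp Require Import all_boot all_order all_algebra.
From mathcomp Require Import all_classical all_reals all_analysis.
From mathcomp Require Import ring.

Set Implicit Arguments.
Unset Strict Implicit.
Unset Printing Implicit Defensive.

Import Order.TTheory GRing.Theory Num.Theory.
Import numFieldNormedType.Exports.

Local Open Scope classical_set_scope.
Local Open Scope ring_scope.

(* Iterated Cayley-Dickson doubling of the reals: R, C, H, O, ... for
   n = 0, 1, 2, 3, ...  The (product, max-norm) topology is that of R^(2^n). *)
Fixpoint cayley_dickson (R : realType) (n : nat) : normedModType R :=
  if n is m.+1 then (cayley_dickson R m * cayley_dickson R m)%type else R^o.

Fixpoint cd_one (R : realType) (n : nat) : cayley_dickson R n :=
  match n return cayley_dickson R n with
  | 0 => 1 : R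
  | m.+1 => (cd_one R m, 0)
  end.

Fixpoint cd_re (R : realType) (n : nat) : cayley_dickson R n -> R :=
  match n return cayley_dickson R n -> R with
  | 0 => fun x => x
  | m.+1 => fun x => cd_re x.1
  end.

Fixpoint cd_conj (R : realType) (n : nat) :
    cayley_dickson R n -> cayley_dickson R n :=
  match n return cayley_dickson R n -> cayley_dickson R n with
  | 0 => fun x => x
  | m.+1 => fun x => (cd_conj x.1, - x.2)
  end.

Fixpoint cd_mul (R : realType) (n : nat) :
    cayley_dickson R n -> cayley_dickson R n -> cayley_dickson R n :=
  match n return
    cayley_dickson R n -> cayley_dickson R n -> cayley_dickson R n with
  | 0 => fun x y => (x : R) * (y : R)
  | m.+1 => fun x y =>
      (cd_mul x.1 y.1 - cd_mul (cd_conj y.2) x.2,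
       cd_mul y.2 x.1 + cd_mul x.2 (cd_conj y.1))
  end.

Section CayleyDicksonTheory.
Variable R : realType.
Local Notation A := (cayley_dickson R).

Lemma cd_reD n (x y : A n) : cd_re (x + y) = cd_re x + cd_re y.
Proof. by elim: n x y => //= n IHn x y; rewrite IHn. Qed.

Lemma cd_reZ n (c : R) (x : A n) : cd_re (c *: x) = c * cd_re x.
Proof. by elim: n x => //= n IHn x; rewrite IHn. Qed.

Lemma cd_re1 n : cd_re (cd_one R n) = 1.
Proof. by elim: n. Qed.

Lemma cd_conjE n (x : A n) :
  cd_conj x = (2 * cd_re x) *: cd_one R n - x.
Proof.
elim: n x => [x|n IHn [a b]] /=; first by rewrite /GRing.scale /=; ring.
by rewrite IHn; congr pair; rewrite /= scaler0 add0r.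
Qed.

Lemma cd_bilinear n :
  [/\ forall x y z : A n, cd_mul (x + y) z = cd_mul x z + cd_mul y z,
      forall x y z : A n, cd_mul x (y + z) = cd_mul x y + cd_mul x z,
      forall (c : R) (x y : A n), cd_mul (c *: x) y = c *: cd_mul x y &
      forall (c : R) (x y : A n), cd_mul x (c *: y) = c *: cd_mul x y].
Proof.
have conjD m (x y : A m) : cd_conj (x + y) = cd_conj x + cd_conj y.
  by rewrite !cd_conjE cd_reD mulrDr scalerDl opprD addrACA.
have conjZ m (c : R) (x : A m) : cd_conj (c *: x) = c *: cd_conj x.
  by rewrite !cd_conjE cd_reZ scalerBr scalerA mulrCA.
elim: n => [|n [Dl Dr Zl Zr]] /=.
  split=> [x y z|x y z|c x y|c x y]; rewrite /GRing.scale /=.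
  - exact: mulrDl.
  - exact: mulrDr.
  - by rewrite mulrA.
  - by rewrite mulrCA.
split=> [x y z|x y z|c x y|c x y]; congr pair;
  rewrite /= ?conjD ?conjZ ?Dl ?Dr ?Zl ?Zr -?scalerBr -?scalerDr //;
  by rewrite ?opprD addrACA.
Qed.

Lemma cd_mulDl n (x y z : A n) : cd_mul (x + y) z = cd_mul x z + cd_mul y z.
Proof. by case: (cd_bilinear n). Qed.

Lemma cd_mulDr n (x y z : A n) : cd_mul x (y + z) = cd_mul x y + cd_mul x z.
Proof. by case: (cd_bilinear n). Qed.

Lemma cd_mulZl n (c : R) (x y : A n) : cd_mul (c *: x) y = c *: cd_mul x y.
Proof. by case: (cd_bilinear n). Qed.

Lemma cd_mulZr n (c : R) (x y : A n) : cd_mul x (c *: y) = c *: cd_mul x y.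
Proof. by case: (cd_bilinear n). Qed.

Lemma cd_mulNl n (x y : A n) : cd_mul (- x) y = - cd_mul x y.
Proof. by rewrite -scaleN1r cd_mulZl scaleN1r. Qed.

Lemma cd_mulNr n (x y : A n) : cd_mul x (- y) = - cd_mul x y.
Proof. by rewrite -scaleN1r cd_mulZr scaleN1r. Qed.

Lemma cd_mul0l n (x : A n) : cd_mul 0 x = 0.
Proof. by rewrite -[X in cd_mul X x](scale0r 0) cd_mulZl scale0r. Qed.

Lemma cd_mul0r n (x : A n) : cd_mul x 0 = 0.
Proof. by rewrite -[X in cd_mul x X](scale0r 0) cd_mulZr scale0r. Qed.

Lemma cd_conj1 n : cd_conj (cd_one R n) = cd_one R n.
Proof. by rewrite cd_conjE cd_re1 mulr1 scaler_nat mulr2n addrK. Qed.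

Lemma cd_conj0 n : cd_conj (0 : A n) = 0.
Proof. by elim: n => //= n IHn; rewrite IHn oppr0. Qed.

Lemma cd_mul1l n (x : A n) : cd_mul (cd_one R n) x = x.
Proof.
elim: n x => [x|n IHn [a b]] /=; first exact: mul1r.
have mul1 : cd_mul b (cd_one R n) = b.
  elim: {IHn a} n b => [b|n IHn [a b]] /=; first exact: mulr1.
  by rewrite cd_conj1 cd_conj0 !cd_mul0l IHn IHn subr0 add0r.
by rewrite IHn mul1 cd_mul0r cd_mul0l subr0 addr0.
Qed.

Lemma cd_mul1r n (x : A n) : cd_mul x (cd_one R n) = x.
Proof.
elim: n x => [x|n IHn [a b]] /=; first exact: mulr1.
by rewrite cd_conj1 cd_conj0 !cd_mul0l !IHn subr0 add0r.
Qed.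

Fixpoint cd_sqnorm n : A n -> R :=
  match n return A n -> R with
  | 0 => fun x => x ^+ 2
  | m.+1 => fun x => cd_sqnorm x.1 + cd_sqnorm x.2
  end.

Lemma cd_mul_conjl n (x : A n) :
  cd_mul (cd_conj x) x = cd_sqnorm x *: cd_one R n.
Proof.
elim: n x => [x|n IHn [a b]] /=; first by rewrite /GRing.scale /= mulr1.
rewrite cd_mulNr opprK !IHn -scalerDl cd_mulNl subrr.
by congr pair; rewrite /= scaler0.
Qed.

Lemma cd_sqr n (x : A n) :
  cd_mul x x = (2 * cd_re x) *: x - cd_sqnorm x *: cd_one R n.
Proof.
rewrite -cd_mul_conjl cd_conjE cd_mulDl cd_mulNl cd_mulZl cd_mul1l.
by rewrite opprB addrC subrK.
Qed.

End CayleyDicksonTheory.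

Variant hypercomplex := Quaternions | Octonions.

Definition hypercomplex_rank (k : hypercomplex) : nat :=
  match k with Quaternions => 2 | Octonions => 3 end.

Definition KK (R : realType) (k : hypercomplex) : normedModType R :=
  cayley_dickson R (hypercomplex_rank k).

Section Logarithm.
Variables (R : realType) (k : hypercomplex).
Local Notation K := (KK R k).

Definition kone : K := cd_one R _.
Definition kmul (p q : K) : K := cd_mul p q.

(* The octonions are power-associative: the bracketing is immaterial. *)
Definition kpow (q : K) (n : nat) : K := iter n (kmul q) kone.

Definition kexp (q : K) : K :=
  limn (series (fun n => (n`!%:R)^-1 *: kpow q n)).

Definition imaginary_space : set K := [set p | cd_re p = 0].

Definition unit_sphere : set K := [set I | kmul I I = - kone].

Definition sinh (x : R) : R := (expR x - expR (- x)) / 2.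

(* A subset of K * Im K, see [log_manifold_sub]. *)
Definition log_manifold : set (K * K) :=
  [set z | exists x y : R, exists I : K,
     [/\ 0 < x, unit_sphere I &
      z = ((sinh x * cos y) *: kone + (sinh x * sin y) *: I, y *: I)]].

Lemma unit_sphere_imaginary : unit_sphere `<=` imaginary_space.
Proof.
rewrite /unit_sphere /kmul /kone => I /= II.
have E : (2 * cd_re I) *: I = (cd_sqnorm I - 1) *: cd_one R _.
  by rewrite scalerBl scale1r -II cd_sqr addrC subrK.
have [//|re_neq0] := eqVneq (cd_re I) 0.
have {E} [c Ic] : exists c, I = c *: cd_one R _.
  exists ((2 * cd_re I)^-1 * (cd_sqnorm I - 1)).
  by rewrite -scalerA -E scalerK// mulf_neq0// pnatr_eq0.
have /(congr1 (@cd_re R _)) := II; rewrite Ic cd_mulZl cd_mulZr cd_mul1l.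
rewrite -scaleN1r !cd_reZ cd_re1 !mulr1 => cc.
by have := sqr_ge0 c; rewrite expr2 cc ler0N1.
Qed.

Lemma log_manifold_sub : log_manifold `<=` setT `*` imaginary_space.
Proof.
move=> _ [x [y [I [_ /unit_sphere_imaginary I0 ->]]]]; split => //=.
by rewrite /imaginary_space /= cd_reZ I0 mulr0.
Qed.

(* Paths are total functions, of which only the values on [a, b] matter. *)
Definition is_path (T : topologicalType) (a b : R) (A : set T) (f : R -> T) :=
  {within `[a, b], continuous f} /\ (forall t, t \in `[a, b] -> A (f t)).

Definition is_lift (a b : R) (g : R -> K) (G : R -> K * K) :=
  is_path a b log_manifold G /\ (forall t, t \in `[a, b] -> (G t).1 = g t).

Definition is_log_continuation (a b : R) (g g' : R -> K) :=
  is_path a b setT g' /\ (forall t, t \in `[a, b] -> kexp (g' t) = g t).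

End Logarithm.

(* Main.v *)
Require Import Defs.
From HB Require Import structures.
From mathcomp Require Import all_boot all_order all_algebra.
From mathcomp Require Import all_classical all_reals all_analysis.
From mathcomp Require Import ring lra.

Import Order.TTheory GRing.Theory Num.Theory.
Import numFieldNormedType.Exports.

Local Open Scope classical_set_scope.
Local Open Scope ring_scope.

(* A lift [(gamma, p)] and a continuation [gamma'] determine each other through
   [gamma' = ln |gamma| + p] and [p = Im gamma'], both continuous expressions.
   This rests on [exp (c + y I) = e^c cos y + e^c sin y I] for [I] in the unit
   sphere, on [|gamma| = sinh x] for a point of the manifold over [gamma], and
   on [sinh] mapping the positive reals onto themselves. *)

(** * Squared norm and real part on the Cayley-Dickson algebras *)

Lemma cd_sqnorm_ge0 {R : realType} {n} (x : cayley_dickson R n) :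
  0 <= cd_sqnorm x.
Proof. by elim: n x => [x|n IHn x] /=; rewrite ?sqr_ge0 ?addr_ge0. Qed.

Lemma cd_sqnorm_eq0 {R : realType} {n} (x : cayley_dickson R n) :
  (cd_sqnorm x == 0) = (x == 0).
Proof.
elim: n x => [x|n IHn [x y]] /=; first by rewrite sqrf_eq0.
by rewrite paddr_eq0 ?cd_sqnorm_ge0// !IHn.
Qed.

Lemma cd_sqnormZ {R : realType} {n} (c : R) (x : cayley_dickson R n) :
  cd_sqnorm (c *: x) = c ^+ 2 * cd_sqnorm x.
Proof.
elim: n x => [x|n IHn x] /=; first exact: exprMn.
by rewrite !IHn mulrDr.
Qed.

Lemma cd_sqnorm_scalarD {R : realType} {n} (c : R) (x : cayley_dickson R n) :
  cd_sqnorm (c *: cd_one R n + x) = c ^+ 2 + 2 * c * cd_re x + cd_sqnorm x.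
Proof.
elim: n x => [x|n IHn x] /=; first by rewrite /GRing.scale /= mulr1; ring.
by rewrite IHn scaler0 add0r addrA.
Qed.

Lemma cd_re_continuous (R : realType) n : continuous (@cd_re R n).
Proof.
elim: n => [|n IHn] x /=; first exact: cvg_id.
by apply: (@cvg_comp _ _ _ fst (@cd_re R n)); [exact: cvg_fst|exact: IHn].
Qed.

Lemma cd_sqnorm_continuous (R : realType) n : continuous (@cd_sqnorm R n).
Proof.
elim: n => [|n IHn] x /=; first exact: exprn_continuous.
apply: cvgD.
  by apply: (@cvg_comp _ _ _ fst (@cd_sqnorm R n)); [exact: cvg_fst|exact: IHn].
by apply: (@cvg_comp _ _ _ snd (@cd_sqnorm R n)); [exact: cvg_snd|exact: IHn].
Qed.

(** * The unit sphere and the polar form of imaginary elements *)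

Lemma unit_sphereP {R : realType} {k} (I : KK R k) :
  unit_sphere I <-> cd_re I = 0 /\ cd_sqnorm I = 1.
Proof.
split=> [SI|[re0 n1]]; last first.
  (* For [cd_re I = 0] the quadratic relation [cd_sqr] reads I I = -|I|^2. The other direction uses
     the same relation and compares real parts. *)
  by rewrite /unit_sphere /= /kmul cd_sqr re0 n1 mulr0 scale0r sub0r scale1r.
have re0 : cd_re I = 0 by exact: unit_sphere_imaginary SI.
split=> //; move: SI; rewrite /unit_sphere /= /kmul cd_sqr re0 mulr0 scale0r.
by rewrite sub0r => /oppr_inj/(congr1 (@cd_re R _)); rewrite cd_reZ cd_re1 mulr1.
Qed.

Lemma unit_sphere_neq0 (R : realType) k : exists I : KK R k, unit_sphere I.
Proof.
have re0 n : cd_re (0 : cayley_dickson R n) = 0 by elim: n.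
have n0 n : cd_sqnorm (0 : cayley_dickson R n) = 0.
  by apply/eqP; rewrite cd_sqnorm_eq0.
have n1 n : cd_sqnorm (cd_one R n) = 1.
  by rewrite -[cd_one R n]scale1r -[1 *: _]addr0 cd_sqnorm_scalarD re0 n0; ring.
(* The new imaginary unit introduced by the last doubling. *)
case: k; [exists (0, cd_one R 1)|exists (0, cd_one R 2)]; apply/unit_sphereP.
  by split=> /=; rewrite ?(n0 1%N, n1 1%N) //; ring.
by split=> /=; rewrite ?(n0 2%N, n1 2%N) //; ring.
Qed.

(** Normalise a nonzero [p]; for [p = 0] any point of the sphere serves, with [y = 0]. *)
Lemma imaginary_polar {R : realType} {k} (p : KK R k) :
  cd_re p = 0 -> exists (y : R) (I : KK R k), unit_sphere I /\ p = y *: I.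
Proof.
move=> p0; have [->|pN0] := eqVneq p 0.
  by have [I SI] := unit_sphere_neq0 R k; exists 0, I; rewrite scale0r.
have np : 0 < cd_sqnorm p by rewrite lt0r cd_sqnorm_eq0 pN0 cd_sqnorm_ge0.
have sN0 : Num.sqrt (cd_sqnorm p) != 0 by rewrite gt_eqF ?sqrtr_gt0.
exists (Num.sqrt (cd_sqnorm p)), ((Num.sqrt (cd_sqnorm p))^-1 *: p).
rewrite scalerA divff// scale1r; split=> //; apply/unit_sphereP.
rewrite cd_reZ p0 mulr0 cd_sqnormZ exprVn sqr_sqrtr ?ltW//.
by rewrite mulVf ?gt_eqF.
Qed.

(** * The hyperbolic sine on the positive reals *)

Lemma sinh_gt0 {R : realType} (x : R) : 0 < x -> 0 < sinh x.
Proof. by move=> x0; rewrite divr_gt0// subr_gt0 ltr_expR gtrN. Qed.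

Lemma sinh_pos_surj {R : realType} (s : R) :
  0 < s -> exists2 x, 0 < x & sinh x = s.
Proof.
move=> s0; pose r := Num.sqrt (s ^+ 2 + 1).
have r2 : r ^+ 2 = s ^+ 2 + 1 by rewrite sqr_sqrtr// addr_ge0 ?sqr_ge0.
have r1 : 1 < r by rewrite -[1]sqrtr1 ltr_sqrt ?ltrDr ?exprn_gt0// addr_gt0 ?exprn_gt0.
(* The classical formula arsinh s = ln (s + sqrt (s^2 + 1)); the inverse of [s + r] is [r - s]
   because r^2 - s^2 = 1. *)
exists (ln (s + r)); first by rewrite ln_gt0//; lra.
rewrite /sinh expRN lnK; last by rewrite posrE; lra.
have -> : (s + r)^-1 = r - s.
  by apply: (@mulfI _ (s + r)); rewrite ?divff ?gt_eqF//; nra.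
lra.
Qed.

(** * Exponential generating functions of geometrically bounded sequences *)

Section ExponentialGeneratingFunction.
Context {R : realType}.
Implicit Types (c : R^nat) (C M x : R).

(** With the factorial kept apart from [c], differentiation becomes a shift of [c]. *)
Definition egf c (x : R) : R := limn (pseries (fun n => c n / n`!%:R) x).

(** Comparison with the series of C exp (M |x|). *)
Lemma cvg_egf [c C M] (cM : forall n, `|c n| <= C * M ^+ n) x :
  pseries (fun n => c n / n`!%:R) x @ \oo --> egf c x.
Proof.
suff: cvgn (pseries (fun n => c n / n`!%:R) x) by [].
rewrite /pseries; apply: normed_cvg; pose v := C *: exp_coeff (M * `|x|).
have le n : `|c n / n`!%:R * x ^+ n| <= v n.
  have -> : v n = C * M ^+ n / n`!%:R * `|x| ^+ n.
    transitivity (C * ((M * `|x|) ^+ n / n`!%:R)) => //.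
    by rewrite exprMn -!mulrA [X in M ^+ n * X]mulrC.
  by rewrite 2!normrM normfV normr_nat normrX !ler_wpM2r ?exprn_ge0.
apply: (@series_le_cvg _ _ v) => [n|n|n|]; [exact: normr_ge0|exact: le_trans (le n)|exact: le|].
exact/is_cvg_seriesZ/is_cvg_series_exp_coeff.
Qed.

Lemma is_derive_egf [c C M] (cM : forall n, `|c n| <= C * M ^+ n) x :
  is_derive x (1 : R) (egf c) (egf (fun n => c n.+1) x).
Proof.
have shift (d : R^nat) : pseries_diffs (fun n => d n / n`!%:R) =
    (fun n => d n.+1 / n`!%:R).
  apply/funext => n; rewrite /pseries_diffs factS natrM invfM mulrCA.
  by rewrite mulVKf ?pnatr_eq0.
(* Shifted sequences keep a geometric bound, so the series of the first and second derivatives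
   converge as well. *)
have cS m n : `|c (m + n)%N| <= C * M ^+ m * M ^+ n.
  by rewrite -mulrA -exprD.
(* Termwise differentiation at [x] asks for convergence at a point of larger modulus, here |x| +
   1. *)
rewrite /egf -(shift c); apply: (@pseries_snd_diffs _ _ (`|x| + 1)).
- exact: cvgP (cvg_egf cM _).
- rewrite shift; exact: cvgP (cvg_egf (cS 1%N) _).
- rewrite 2!shift; exact: cvgP (cvg_egf (cS 2%N) _).
- by rewrite ltr_normr ltrDl ltr01.
Qed.

Lemma egf_lin [c1 c2 C M] (s t x : R) :
    (forall n, `|c1 n| <= C * M ^+ n) -> (forall n, `|c2 n| <= C * M ^+ n) ->
  egf (fun n => s * c1 n + t * c2 n) x = s * egf c1 x + t * egf c2 x.
Proof.
move=> h1 h2; rewrite {1}/egf.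
have -> : pseries (fun n => (s * c1 n + t * c2 n) / n`!%:R) x =
    (fun n => s * pseries (fun n => c1 n / n`!%:R) x n +
              t * pseries (fun n => c2 n / n`!%:R) x n).
  apply/funext => n; rewrite /pseries /series /= !mulr_sumr -big_split /=.
  by apply: eq_bigr => i _; ring.
by apply: cvg_lim => //; apply: cvgD; apply: cvgMr; apply: cvg_egf.
Qed.

End ExponentialGeneratingFunction.

(** * Real and imaginary parts of exp ((c + i y) x) *)

Section ComplexExponential.
Context {R : realType} (c y : R).

(* The real and imaginary parts of [(c + i y) ^+ n]. *)
Definition cpow (n : nat) : R * R :=
  iter n (fun z => (c * z.1 - y * z.2, y * z.1 + c * z.2)) (1, 0).

Let re n := (cpow n).1.
Let im n := (cpow n).2.
Let M := `|c| + `|y|.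

(** Each step combines the two parts with coefficients [c] and [y] up to sign, which costs at most a
    factor |c| + |y|. *)
Lemma cpow_le n : `|re n| <= 1 * M ^+ n /\ `|im n| <= 1 * M ^+ n.
Proof.
rewrite mul1r /re /im; elim: n => [|n [IHr IHi]] /=.
  by rewrite normr1 normr0 expr0.
have bound (s t u v : R) : `|u| <= M ^+ n -> `|v| <= M ^+ n ->
    `|s * u + t * v| <= (`|s| + `|t|) * M ^+ n.
  move=> u1 v1; rewrite (le_trans (ler_normD _ _))// mulrDl !normrM.
  by rewrite lerD// ler_wpM2l.
rewrite exprS; split; last first.
  by rewrite (le_trans (bound _ _ _ _ IHr IHi))// [`|y| + _]addrC.
by rewrite -mulNr (le_trans (bound _ _ _ _ IHr IHi))// normrN.
Qed.

Let F := egf re.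
Let G := egf im.

(** The recursion of [cpow] is linear, so the shift of coefficients yields the system F' = c F - y
    G, G' = y F + c G. *)
Let dF x : is_derive x (1 : R) F (c * F x - y * G x).
Proof.
have h n := (cpow_le n).1; have h' n := (cpow_le n).2.
have -> : c * F x - y * G x = egf (fun n => re n.+1) x.
  rewrite -mulNr -(egf_lin c (- y) x h h'); congr egf.
  by apply/funext => n; rewrite mulNr.
exact: is_derive_egf h x.
Qed.

Let dG x : is_derive x (1 : R) G (y * F x + c * G x).
Proof.
have h n := (cpow_le n).1; have h' n := (cpow_le n).2.
rewrite -(egf_lin y c x h h'); exact: is_derive_egf h' x.
Qed.

Let F0 : F 0 = 1.
Proof.
(* The empty partial sum is 0; from index 1 on the partial sums at 0 are constant, hence the
   shift. *)
apply: cvg_lim => //; rewrite -(cvg_shiftS _); apply: cvg_near_cst.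
apply: nearW => n; rewrite /pseries /series /= big_nat_recl// big1.
  by rewrite expr0 fact0 invr1 !mulr1 addr0.
by move=> i _; rewrite exprS mul0r mulr0.
Qed.

Let G0 : G 0 = 0.
Proof.
apply: cvg_lim => //; rewrite -(cvg_shiftS _); apply: cvg_near_cst.
apply: nearW => n; rewrite /pseries /series /= big_nat_recl// big1.
  by rewrite /im /= !mul0r addr0.
by move=> i _; rewrite exprS mul0r mulr0.
Qed.

Let dlin (a x : R) : is_derive x (1 : R) (fun x => a * x) a.
Proof.
have -> : (fun x => a * x) = a \*: (@id R) by apply/funext.
by apply: trigger_derive; rewrite /GRing.scale /= mulr1.
Qed.

Let dexp (x : R) :
  is_derive x (1 : R) (fun x => expR (- c * x)) (expR (- c * x) * - c).
Proof. exact: (is_derive1_comp (is_derive_expR _) (dlin _ _)). Qed.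

Let dcos (x : R) :
  is_derive x (1 : R) (fun x => cos (y * x)) (- sin (y * x) * y).
Proof. exact: (is_derive1_comp (is_derive_cos _) (dlin _ _)). Qed.

Let dsin (x : R) :
  is_derive x (1 : R) (fun x => sin (y * x)) (cos (y * x) * y).
Proof. exact: (is_derive1_comp (is_derive_sin _) (dlin _ _)). Qed.

(* [F + i G] solves [f' = (c + i y) f], so that its quotient by
   [expR (c x) (cos (y x) + i sin (y x))] is constant. *)
Lemma egf_cpow x :
  F x = expR (c * x) * cos (y * x) /\ G x = expR (c * x) * sin (y * x).
Proof.
pose E x := expR (- c * x); pose Cs x := cos (y * x); pose Sn x := sin (y * x).
(* [u] and [v] concern the real and imaginary parts of e^(-c x) (F + i G) (cos (y x) - i sin (y
   x)). *)
have u : (E * (F * Cs + G * Sn)) x = (E * (F * Cs + G * Sn)) 0.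
  apply: is_derive_0_is_cst => t.
  refine (is_derive_eq (is_deriveM (dexp t) (is_deriveD
    (is_deriveM (dF t) (dcos t)) (is_deriveM (dG t) (dsin t)))) _).
  by rewrite /GRing.scale /= !fctE /E /Cs /Sn; ring.
have v : (E * (G * Cs - F * Sn)) x = (E * (G * Cs - F * Sn)) 0.
  apply: is_derive_0_is_cst => t.
  refine (is_derive_eq (is_deriveM (dexp t) (is_deriveB
    (is_deriveM (dG t) (dcos t)) (is_deriveM (dF t) (dsin t)))) _).
  by rewrite /GRing.scale /= !fctE /E /Cs /Sn; ring.
move: u v; rewrite !fctE /E /Cs /Sn F0 G0 !mulr0 expR0 cos0 sin0.
rewrite !(mulr0, mulr1, mul0r, addr0, subr0) mulNr => u v.
have EN0 : expR (- (c * x)) != 0 by rewrite gt_eqF ?expR_gt0.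
have {}u : F x * cos (y * x) + G x * sin (y * x) = expR (c * x).
  by apply: (mulfI EN0); rewrite u -expRD addNr expR0.
have {}v : G x * cos (y * x) - F x * sin (y * x) = 0.
  by apply: (mulfI EN0); rewrite v mulr0.
(* The rotation relating (F, G) to (e^(c x), 0) is inverted by multiplying F and G by cos^2 + sin^2
   = 1. *)
have cs := cos2Dsin2 (y * x); move: v => /subr0_eq v; rewrite -u; split.
  by rewrite -[LHS]mulr1 -cs; ring: v.
by rewrite -[LHS]mulr1 -cs; ring: v.
Qed.

End ComplexExponential.

(** * Powers and exponential in the plane spanned by 1 and I *)

Lemma kpow_polar {R : realType} {k} (c y : R) (I : KK R k) n :
  unit_sphere I ->
  kpow (c *: kone R k + y *: I) n =
  (cpow c y n).1 *: kone R k + (cpow c y n).2 *: I.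
Proof.
move=> SI; elim: n => [|n IHn]; first by rewrite /= scale1r scale0r addr0.
(* Bilinearity and I I = -1 turn left multiplication by c + y I into one step of [cpow]. *)
rewrite /kpow iterS -/(kpow _ n) IHn /= /kmul cd_mulDl !cd_mulDr.
rewrite !cd_mulZl !cd_mulZr !cd_mul1l cd_mul1r.
have -> : cd_mul I I = - kone R k by exact: SI.
rewrite !scalerN !scalerA scalerBl scalerDl.
by rewrite [(y * _) *: I - _]addrC addrACA [(c * _) *: I + _]addrC.
Qed.

(** The partial sums split along 1 and I into two real series, which [egf_cpow] evaluates at 1. *)
Lemma kexp_polar {R : realType} {k} (c y : R) (I : KK R k) :
  unit_sphere I ->
  kexp (c *: kone R k + y *: I) =
  (expR c * cos y) *: kone R k + (expR c * sin y) *: I.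
Proof.
move=> SI; have [Fx Gx] := egf_cpow c y 1.
have cvgr := cvg_egf (fun n => (cpow_le c y n).1) 1.
have cvgi := cvg_egf (fun n => (cpow_le c y n).2) 1.
move: cvgr cvgi; rewrite Fx Gx !mulr1 => cvgr cvgi.
pose psum (u : nat -> R) := pseries (fun n => u n / n`!%:R) 1.
have kexpE : series (fun n => n`!%:R^-1 *: kpow (c *: kone R k + y *: I) n) =
    (fun n => psum (fun n => (cpow c y n).1) n *: kone R k +
              psum (fun n => (cpow c y n).2) n *: I).
  apply/funext => n; rewrite /psum /pseries /series /= !scaler_suml -big_split.
  apply: eq_bigr => i _; rewrite kpow_polar// scalerDr !scalerA expr1n !mulr1.
  by rewrite ![_^-1 * _]mulrC.
rewrite /kexp kexpE; apply: cvg_lim; first exact: norm_hausdorff.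
exact: cvgD (cvgZr_tmp cvgr) (cvgZr_tmp cvgi).
Qed.

Theorem proposition4p2 (R : realType) (k : hypercomplex) (a b : R)
    (gamma : R -> KK R k) (hab : a <= b)
    (hgamma : is_path a b [set~ 0] gamma) :
  (exists Gamma : R -> KK R k * KK R k, is_lift a b gamma Gamma) <->
  (exists gamma' : R -> KK R k, is_log_continuation a b gamma gamma').
Proof.
case: hgamma => cgamma gammaN0; split.
  move=> [Gamma [[cGamma mGamma] Gamma1]].
  (* Half the logarithm of the squared norm is ln |gamma|. *)
  exists (fun t => (ln (cd_sqnorm (gamma t)) / 2) *: kone R k + (Gamma t).2).
  split; [split=> //|].
    move=> t; apply: cvgD; last first.
      by apply: (cvg_comp _ _ (cGamma t)); exact: cvg_snd.
    apply: cvgZr_tmp; apply: cvgMl.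
    (* [ln] is continuous only at positive points; the squared norm is positive along [gamma], which
       avoids 0. *)
    have : {within `[a, b], continuous ((@ln R \o @cd_sqnorm R _) \o gamma)}.
      apply: within_continuous_comp cgamma => q; rewrite inE => -[s sab <-].
      apply: continuous_comp; first exact: cd_sqnorm_continuous.
      apply: continuous_ln; rewrite lt0r cd_sqnorm_ge0 cd_sqnorm_eq0 andbT.
      exact/eqP/gammaN0.
    by move=> /(_ t).
  move=> t tab; have [x [y [I [x0 SI GammaE]]]] := mGamma t tab.
  have [re0 n1] := (unit_sphereP I).1 SI.
  have sx := sinh_gt0 _ x0.
  rewrite -Gamma1// GammaE /= kexp_polar//.
  have -> : cd_sqnorm ((sinh x * cos y) *: kone R k + (sinh x * sin y) *: I) =
      sinh x ^+ 2.
    rewrite cd_sqnorm_scalarD cd_reZ re0 cd_sqnormZ n1 !mulr0 addr0 mulr1.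
    by rewrite !exprMn -mulrDr cos2Dsin2 mulr1.
  by rewrite lnXn// -[ln _ *+ 2]mulr_natr mulfK// lnK.
move=> [gamma' [[cgamma' _] expgamma']].
pose im (q : KK R k) := q - cd_re q *: kone R k.
have cim : continuous im.
  move=> q; apply: cvgB; first exact: cvg_id.
  by apply: cvgZr_tmp; exact: cd_re_continuous.
exists (fun t => (gamma t, im (gamma' t))); split=> //; split.
  move=> t; apply: cvg_pair; first exact: cgamma.
  exact: (cvg_comp _ _ (cgamma' t) (cim _)).
move=> t tab.
have im0 : cd_re (im (gamma' t)) = 0.
  by rewrite /im -scaleN1r cd_reD !cd_reZ cd_re1; ring.
have [y [I [SI imE]]] := imaginary_polar _ im0.
(* The modulus of [gamma t] = exp ([gamma' t]) is e to the real part of [gamma' t], so this value is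
   forced on sinh x. *)
have [x x0 sx] := sinh_pos_surj _ (expR_gt0 (cd_re (gamma' t))).
exists x, y, I; split=> //; rewrite imE -expgamma'// sx -kexp_polar// -imE.
by congr (kexp _, _); rewrite /im [RHS]addrC subrK.
Qed.
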